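(* Let $\widetilde L=x(1-x)\frac{d^2}{dx^2}+[c-(a+b+1)x]\frac{d}{dx}$ and let $y_1(x)={}_2F_1(a,b;c;x)$ (a solution of $\widetilde Ly_1=ab\,y_1$), normalized so that $\langle y_1,y_1\rangle_\omega=1$. Let $f$ be a continuous function. If $\tilde y(x)=y_1(x)+\mathcal{O}(\rho)$ is an eigenfunction of the deformed operator $\widetilde L+\rho f(x)$, i.e. $$[\widetilde L+\rho f(x)]\,\tilde y=\tilde\lambda_\rho\,\tilde y,$$ with eigenvalue $\tilde\lambda_\rho=ab+\lambda_1\rho+\mathcal{O}(\rho^2)$, then $$\lambda_1=\int_0^1|y_1(x)|^2\,\omega(x)\,f(x)\,dx .$$
   Context: $a,b,c$ are the (generic) parameters of the hypergeometric equation $x(1-x)y''+[c-(a+b+1)x]y'-ab\,y=0$. The weight is $\omega(x)=x^{c-1}(1-x)^{a+b-c}$ on $(0,1)$ and $\langle g,h\rangle_\omega=\int_0^1 g(x)\overline{h(x)}\,\omega(x)\,dx$. Both $\tilde\lambda_\rho$ and $\tilde y$ are expanded as formal power series in $\rho$: $\tilde y=y_1+\rho\,y_{1,1}+\rho^2y_{1,2}+\cdots$.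
   Formalization: a+b, ab and c are taken real (c not 0,-1,-2,...), and for each coefficient u of ỹ the boundary term x(1-x)ω(u'ȳ₁ - uȳ₁') must have equal limits at 0 and 1 (tacit boundary conditions); without these, any λ₁ is possible, e.g. λ₁=1 with f=0. *)

(* Defs.v *)
From Stdlib Require Import Reals Factorial.
From Coquelicot Require Import Coquelicot.
Open Scope R_scope.

Fixpoint poch (z : C) (n : nat) : C :=
  match n with
  | O => RtoC 1
  | S m => (poch z m * (z + RtoC (INR m)))%C
  end.

Definition hyp2F1_coef (a b : C) (c : R) (n : nat) : C :=
  (poch a n * poch b n / (poch (RtoC c) n * RtoC (INR (fact n))))%C.

(** The Gauss series.  Coquelicot's [PSeries] is real-valued, so the complex
    series is summed componentwise; it is only meaningful for [|x| < 1]. *)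
Definition hyp2F1 (a b : C) (c x : R) : C :=
  (PSeries (fun n => Re (hyp2F1_coef a b c n)) x,
   PSeries (fun n => Im (hyp2F1_coef a b c n)) x).

(** Derivative of a complex-valued function of a real variable; meaningful
    where [ex_derive] holds. *)
Definition CDerive (u : R -> C) (x : R) : C :=
  (Derive (fun t => Re (u t)) x, Derive (fun t => Im (u t)) x).

Definition twice_derivable_at (u : R -> C) (x : R) : Prop :=
  ex_derive (V := C_R_NormedModule) u x /\
  ex_derive (V := C_R_NormedModule) (CDerive u) x.

Definition hypL (a b : C) (c : R) (u : R -> C) (x : R) : C :=
  (RtoC (x * (1 - x)) * CDerive (CDerive u) x
   + (RtoC c - (a + b + 1) * RtoC x) * CDerive u x)%C.

(** Used only when [a + b] is real, whence the [Re]. *)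
Definition hyp_weight (a b : C) (c x : R) : R :=
  Rpower x (c - 1) * Rpower (1 - x) (Re (a + b)%C - c).

(** [int_0^1 g], as an improper integral at both ends. *)
Definition is_int01 (g : R -> C) (v : C) : Prop :=
  is_RInt_gen (V := C_R_NormedModule) g (at_right 0) (at_left 1) v.

Definition is_inner (a b : C) (c : R) (g h : R -> C) (v : C) : Prop :=
  is_int01 (fun x => g x * Cconj (h x) * RtoC (hyp_weight a b c x))%C v.

(** The Lagrange bracket [p (u' conj v - u conj v')], where
    [p = x (1 - x) omega = x^c (1 - x)^(a+b-c+1)].  When the coefficients of
    [hypL] are real, its derivative is
    [omega (hypL u * conj v - u * conj (hypL v))]. *)
Definition lagrange_bracket (a b : C) (c : R) (u v : R -> C) (x : R) : C :=
  (RtoC (x * (1 - x) * hyp_weight a b c x)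
   * (CDerive u x * Cconj (v x) - u x * Cconj (CDerive v x)))%C.

(** The boundary term of Green's formula for [u] and [v] on (0,1) vanishes:
    the bracket has the same limit at both endpoints (0 in the case of
    separated boundary conditions).  It holds for any two functions in a domain
    on which [hypL] is symmetric for the [omega]-inner product. *)
Definition boundary_term_vanishes (a b : C) (c : R) (u v : R -> C) : Prop :=
  exists l : C,
    filterlim (lagrange_bracket a b c u v) (at_right 0) (locally l) /\
    filterlim (lagrange_bracket a b c u v) (at_left 1) (locally l).

(** Formal power series in [rho] are coefficient sequences.  The next two
    definitions give the coefficients of [(hypL + rho f) Y] and of the Cauchy
    product [lam Y]. *)
Definition deformed_op (a b : C) (c : R) (f : R -> C) (Y : nat -> R -> C)
    (n : nat) (x : R) : C :=
  (hypL a b c (Y n) x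
   + match n with O => RtoC 0 | S m => f x * Y m x end)%C.

Definition fps_mul (lam : nat -> C) (Y : nat -> R -> C) (n : nat) (x : R) : C :=
  sum_n (fun k => lam k * Y (n - k)%nat x)%C n.

(** [Y] is a formal eigenfunction of [hypL + rho f] on (0,1) with formal
    eigenvalue [lam], subject to the boundary conditions carried by [y].
    Without boundary conditions the differential equation alone would be
    solvable in [Y] for every choice of [lam 1], [lam 2], ... *)
Definition deformed_eigenfunction (a b : C) (c : R) (f y : R -> C)
    (lam : nat -> C) (Y : nat -> R -> C) : Prop :=
  (forall n x, 0 < x < 1 -> twice_derivable_at (Y n) x) /\
  (forall n, boundary_term_vanishes a b c (Y n) y) /\
  (forall n x, 0 < x < 1 -> deformed_op a b c f Y n x = fps_mul lam Y n x).

(* Main.v *)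
Require Import Defs.
From Stdlib Require Import Reals.
From Coquelicot Require Import Coquelicot.
From Stdlib Require Import Lra.
Open Scope R_scope.

(** Let [W] be the Lagrange bracket of the first-order term [Y 1] and [y1].  Since
    [ab] is real, Lagrange's identity and the equations of orders 0 and 1 in [rho]
    give [W' = (lam 1 - f) |y1|^2 omega], the terms in [ab] cancelling.  The limits
    of [W] at 0 and 1 agree, so the integral of [W'] over (0,1) is 0, and the
    normalization of [y1] turns this into the formula for [lam 1].  The equation
    [L y1 = ab y1] is read off from order 0, not from the Gauss series. *)

(** * Componentwise differentiation of complex-valued functions of a real variable *)

Lemma is_derive_Re (u : R -> C) (x : R) (l : C) :
  is_derive (V := C_R_NormedModule) u x l -> is_derive (fun t => Re (u t)) x (Re l).
Proof.
  intro H.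
  exact (filterdiff_comp' u fst x _ fst H (filterdiff_linear _ is_linear_fst)).
Qed.

Lemma is_derive_Im (u : R -> C) (x : R) (l : C) :
  is_derive (V := C_R_NormedModule) u x l -> is_derive (fun t => Im (u t)) x (Im l).
Proof.
  intro H.
  exact (filterdiff_comp' u snd x _ snd H (filterdiff_linear _ is_linear_snd)).
Qed.

(** Write [u] as [Re u] times the vector (1, 0) plus [Im u] times (0, 1); each summand is a real
    function times a constant vector. *)
Lemma is_derive_C (u : R -> C) (x : R) (l : C) :
  is_derive (fun t => Re (u t)) x (Re l) -> is_derive (fun t => Im (u t)) x (Im l) ->
  is_derive (V := C_R_NormedModule) u x l.
Proof.
  intros Hr Hi.
  pose proof (is_derive_plus _ _ _ _ _
    (is_derive_scal_l (V := C_R_NormedModule) _ _ _ (1, 0) Hr)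
    (is_derive_scal_l (V := C_R_NormedModule) _ _ _ (0, 1) Hi)) as H.
  apply (is_derive_ext _ u) in H.
  - replace l with (plus (scal (Re l) ((1, 0) : C_R_NormedModule))
      (scal (Im l) ((0, 1) : C_R_NormedModule))); [exact H|].
    destruct l as [p q].
    cbn. unfold prod_plus, prod_scal; cbn.
    f_equal; unfold plus, scal, mult; cbn; unfold mult; cbn; ring.
  - intro t. destruct (u t) as [p q].
    cbn. unfold prod_plus, prod_scal; cbn.
    f_equal; unfold plus, scal, mult; cbn; unfold mult; cbn; ring.
Qed.

(** [CDerive] is assembled from the total function [Derive], so it is a true derivative only once
    both components are known to be differentiable; projecting a derivative of [u] shows that they
    are. *)
Lemma is_derive_CDerive (u : R -> C) (x : R) :
  ex_derive (V := C_R_NormedModule) u x ->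
  is_derive (V := C_R_NormedModule) u x (CDerive u x).
Proof.
  intros [l H]. apply is_derive_C; apply Derive_correct.
  - exists (Re l). now apply is_derive_Re.
  - exists (Im l). now apply is_derive_Im.
Qed.

Lemma is_derive_Cmult (u v : R -> C) (x : R) (du dv : C) :
  is_derive (V := C_R_NormedModule) u x du ->
  is_derive (V := C_R_NormedModule) v x dv ->
  is_derive (V := C_R_NormedModule) (fun t => u t * v t)%C x (du * v x + u x * dv)%C.
Proof.
  intros Hu Hv.
  pose proof (is_derive_Re _ _ _ Hu) as Hu1. pose proof (is_derive_Im _ _ _ Hu) as Hu2.
  pose proof (is_derive_Re _ _ _ Hv) as Hv1. pose proof (is_derive_Im _ _ _ Hv) as Hv2.
  apply is_derive_C.
  - evar_last.
    + apply (is_derive_minus _ _ _ _ _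
        (is_derive_mult _ _ _ _ _ Hu1 Hv1 Rmult_comm)
        (is_derive_mult _ _ _ _ _ Hu2 Hv2 Rmult_comm)).
    + unfold minus, plus, opp, mult, Re, Im; simpl. ring.
  - evar_last.
    + apply (is_derive_plus _ _ _ _ _
        (is_derive_mult _ _ _ _ _ Hu1 Hv2 Rmult_comm)
        (is_derive_mult _ _ _ _ _ Hu2 Hv1 Rmult_comm)).
    + unfold minus, plus, opp, mult, Re, Im; simpl. ring.
Qed.

Lemma is_derive_Cconj (u : R -> C) (x : R) (du : C) :
  is_derive (V := C_R_NormedModule) u x du ->
  is_derive (V := C_R_NormedModule) (fun t => Cconj (u t)) x (Cconj du).
Proof.
  intro H. apply is_derive_C.
  - exact (is_derive_Re _ _ _ H).
  - exact (is_derive_opp _ _ _ (is_derive_Im _ _ _ H)).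
Qed.

Lemma is_derive_RtoC (u : R -> R) (x du : R) :
  is_derive u x du -> is_derive (V := C_R_NormedModule) (fun t => RtoC (u t)) x (RtoC du).
Proof.
  intro H. apply is_derive_C; [exact H|].
  exact (is_derive_const (K := R_AbsRing) (V := R_NormedModule) 0 x).
Qed.

(** * Componentwise continuity of complex-valued functions *)

Lemma continuous_C {T : UniformSpace} (u : T -> C) (x : T) :
  continuous (fun t => Re (u t)) x -> continuous (fun t => Im (u t)) x -> continuous u x.
Proof.
  intros Hr Hi P [eps HP].
  pose proof (Hr _ (locally_ball (Re (u x)) eps)) as H1.
  pose proof (Hi _ (locally_ball (Im (u x)) eps)) as H2.
  unfold filtermap in H1, H2 |- *.
  generalize (filter_and _ _ H1 H2). apply filter_imp. clear H1 H2.
  intros t [H1 H2]. apply HP. exact (conj H1 H2).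
Qed.

Lemma continuous_Re {T : UniformSpace} (u : T -> C) (x : T) :
  continuous u x -> continuous (fun t => Re (u t)) x.
Proof.
  intro H. apply (continuous_comp u fst x H). destruct (u x). apply continuous_fst.
Qed.

Lemma continuous_Im {T : UniformSpace} (u : T -> C) (x : T) :
  continuous u x -> continuous (fun t => Im (u t)) x.
Proof.
  intro H. apply (continuous_comp u snd x H). destruct (u x). apply continuous_snd.
Qed.

Lemma continuous_Cmult {T : UniformSpace} (u v : T -> C) (x : T) :
  continuous u x -> continuous v x -> continuous (fun t => u t * v t)%C x.
Proof.
  intros Hu Hv.
  pose proof (continuous_Re _ _ Hu) as Hu1. pose proof (continuous_Im _ _ Hu) as Hu2.
  pose proof (continuous_Re _ _ Hv) as Hv1. pose proof (continuous_Im _ _ Hv) as Hv2.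
  apply continuous_C.
  - exact (continuous_minus (V := R_NormedModule) _ _ _
      (continuous_mult _ _ _ Hu1 Hv1) (continuous_mult _ _ _ Hu2 Hv2)).
  - exact (continuous_plus (V := R_NormedModule) _ _ _
      (continuous_mult _ _ _ Hu1 Hv2) (continuous_mult _ _ _ Hu2 Hv1)).
Qed.

(** Pearson's equation for the weight: the derivative of [x (1 - x) omega] is [omega] times the
    first-order coefficient of [hypL]. This puts [hypL] in self-adjoint form. *)
Lemma is_derive_lagrange_factor (a b : C) (c x : R) :
  0 < x < 1 ->
  is_derive (fun t => t * (1 - t) * hyp_weight a b c t) x
    ((c - (Re (a + b)%C + 1) * x) * hyp_weight a b c x).
Proof.
  intro Hx. unfold hyp_weight. generalize (Re (a + b)%C). intro s. unfold Rpower.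
  auto_derive; [lra|]. change (1 + - x) with (1 - x). field. lra.
Qed.

(** * Improper integrals: complex constant factors and the fundamental theorem of calculus *)

Lemma is_RInt_Cmult_l (k : C) (g : R -> C) (s t : R) (v : C) :
  is_RInt (V := C_R_NormedModule) g s t v ->
  is_RInt (V := C_R_NormedModule) (fun x => k * g x)%C s t (k * v)%C.
Proof.
  intro H.
  (* The scalars of [C_R_NormedModule] are real, so the product with [k] is expanded into real and
     imaginary parts. *)
  pose proof (is_RInt_fct_extend_fst _ _ _ _ H) as Hr.
  pose proof (is_RInt_fct_extend_snd _ _ _ _ H) as Hi.
  apply (is_RInt_fct_extend_pair (U := R_NormedModule) (V := R_NormedModule)).
  - exact (is_RInt_minus (V := R_NormedModule) _ _ _ _ _ _
      (is_RInt_scal (V := R_NormedModule) _ _ _ (Re k) _ Hr)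
      (is_RInt_scal (V := R_NormedModule) _ _ _ (Im k) _ Hi)).
  - exact (is_RInt_plus (V := R_NormedModule) _ _ _ _ _ _
      (is_RInt_scal (V := R_NormedModule) _ _ _ (Re k) _ Hi)
      (is_RInt_scal (V := R_NormedModule) _ _ _ (Im k) _ Hr)).
Qed.

Lemma is_RInt_gen_Cmult_l (Fa Fb : (R -> Prop) -> Prop) {FFa : Filter Fa} {FFb : Filter Fb}
    (k : C) (g : R -> C) (v : C) :
  is_RInt_gen (V := C_R_NormedModule) g Fa Fb v ->
  is_RInt_gen (V := C_R_NormedModule) (fun x => k * g x)%C Fa Fb (k * v)%C.
Proof.
  intros H P HP.
  assert (Hk : continuous (fun w : C => k * w)%C v).
  { apply (continuous_Cmult (T := C_UniformSpace));
      [apply continuous_const | apply continuous_id]. }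
  generalize (H _ (Hk P HP)). unfold filtermapi. apply filter_imp. intros st [w [Hw HPw]].
  exists (k * w)%C. split; [now apply is_RInt_Cmult_l | exact HPw].
Qed.

(** The fundamental theorem on each segment with endpoints close to the ends gives [W t - W s], and
    the limits of [W] do the rest; [W] need not be defined continuously at the ends themselves. *)
Lemma is_RInt_gen_derive (V : CompleteNormedModule R_AbsRing)
    (Fa Fb : (R -> Prop) -> Prop) {FFa : Filter Fa} {FFb : Filter Fb}
    (W dW : R -> V) (la lb : V) :
  filter_prod Fa Fb (fun st => forall x, Rmin (fst st) (snd st) <= x <= Rmax (fst st) (snd st) ->
    is_derive W x (dW x) /\ continuous dW x) ->
  filterlim W Fa (locally la) -> filterlim W Fb (locally lb) ->
  is_RInt_gen dW Fa Fb (minus lb la).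
Proof.
  intros H Ha Hb.
  assert (Hlim : filterlim (fun st => minus (W (snd st)) (W (fst st)))
            (filter_prod Fa Fb) (locally (minus lb la))).
  { unfold minus. refine (filterlim_comp_2 _ _ plus _ _ (filterlim_plus lb (opp la))).
    - eapply filterlim_comp; [apply filterlim_snd | exact Hb].
    - eapply filterlim_comp; [|exact (filterlim_opp la)].
      eapply filterlim_comp; [apply filterlim_fst | exact Ha]. }
  intros P HP. specialize (Hlim P HP). unfold filtermap in Hlim.
  generalize (filter_and _ _ H Hlim). unfold filtermapi. apply filter_imp.
  intros st [Hst HPst]. eexists. split; [|exact HPst].
  apply is_RInt_derive; intros x Hx; now apply Hst.
Qed.

(** Once both endpoints lie in (0,1), so does the segment between them, by convexity. [Rmin] and
    [Rmax] appear because the two endpoints need not be ordered. *)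
Lemma filter_prod_01_segment :
  filter_prod (at_right 0) (at_left 1)
    (fun st => forall x, Rmin (fst st) (snd st) <= x <= Rmax (fst st) (snd st) -> 0 < x < 1).
Proof.
  assert (H01 : forall x, Rabs (x - 0) < 1 -> 0 < x -> 0 < x < 1).
  { intros x Hx H0. apply Rabs_def2 in Hx. lra. }
  assert (H10 : forall x, Rabs (x - 1) < 1 -> x < 1 -> 0 < x < 1).
  { intros x Hx H1. apply Rabs_def2 in Hx. lra. }
  exists (fun s => 0 < s < 1) (fun t => 0 < t < 1).
  - exists (mkposreal 1 Rlt_0_1). exact H01.
  - exists (mkposreal 1 Rlt_0_1). exact H10.
  - intros s t Hs Ht x. simpl. unfold Rmin, Rmax. destruct (Rle_dec s t); lra.
Qed.

(** * Local arguments on the open interval (0,1) and Lagrange's identity *)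

Lemma locally_01 (x : R) : 0 < x < 1 -> locally x (fun t => 0 < t < 1).
Proof.
  intro Hx. apply filter_and; [exact (open_gt 0 x (proj1 Hx)) | exact (open_lt 1 x (proj2 Hx))].
Qed.

Lemma CDerive_ext_loc (u v : R -> C) (x : R) :
  locally x (fun t => u t = v t) -> CDerive u x = CDerive v x.
Proof.
  intro H. unfold CDerive.
  f_equal; apply Derive_ext_loc; revert H; apply filter_imp; intros t ->; reflexivity.
Qed.

(** In the product rule the terms [u' conj v'] cancel, and Pearson's equation supplies the
    first-order terms of [hypL]. Reality of [a + b] makes conjugation leave the coefficients of
    [hypL] unchanged. *)
Lemma is_derive_lagrange_bracket (a b : C) (c : R) (u v : R -> C) (x : R) :
  Im (a + b)%C = 0 -> 0 < x < 1 -> twice_derivable_at u x -> twice_derivable_at v x ->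
  is_derive (V := C_R_NormedModule) (lagrange_bracket a b c u v) x
    (RtoC (hyp_weight a b c x)
     * (hypL a b c u x * Cconj (v x) - u x * Cconj (hypL a b c v x)))%C.
Proof.
  intros Hab Hx [Hu Hu'] [Hv Hv'].
  apply is_derive_CDerive in Hu, Hu', Hv, Hv'.
  evar_last.
  - apply (is_derive_Cmult _ _ _ _ _
      (is_derive_RtoC _ _ _ (is_derive_lagrange_factor a b c x Hx))
      (is_derive_minus (V := C_R_NormedModule) _ _ _ _ _
        (is_derive_Cmult _ _ _ _ _ Hu' (is_derive_Cconj _ _ _ Hv))
        (is_derive_Cmult _ _ _ _ _ Hu (is_derive_Cconj _ _ _ Hv')))).
  - unfold hypL.
    (* With [a + b] replaced by a real number, the goal becomes a polynomial identity in real and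
       imaginary parts. *)
    assert (Hs : (a + b)%C = RtoC (Re (a + b)%C)).
    { destruct (a + b)%C as [p q]. simpl in *. now rewrite Hab. }
    rewrite Hs. set (s := Re (a + b)%C). set (w := hyp_weight a b c x).
    destruct (u x) as [u1 u2], (v x) as [v1 v2], (CDerive u x) as [u3 u4],
      (CDerive v x) as [v3 v4], (CDerive (CDerive u) x) as [u5 u6],
      (CDerive (CDerive v) x) as [v5 v6].
    apply injective_projections; simpl; unfold minus, plus, opp, Re, s; simpl;
      ring.
Qed.

Lemma CDerive_eq_01 (u v : R -> C) (x : R) :
  (forall t, 0 < t < 1 -> u t = v t) -> 0 < x < 1 -> CDerive u x = CDerive v x.
Proof.
  intros H Hx. apply CDerive_ext_loc.
  generalize (locally_01 x Hx). apply filter_imp. exact H.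
Qed.

(** Serves to carry the order 0 equation from [Y 0] to [y1], which agree only on (0,1). Openness of
    the interval lets the agreement pass to the first derivative and then to the second. *)
Lemma hypL_eq_01 (a b : C) (c : R) (u v : R -> C) (x : R) :
  (forall t, 0 < t < 1 -> u t = v t) -> 0 < x < 1 -> hypL a b c u x = hypL a b c v x.
Proof.
  intros H Hx. unfold hypL.
  rewrite (CDerive_eq_01 u v x H Hx), (CDerive_eq_01 (CDerive u) (CDerive v) x); auto.
  intros t Ht. now apply CDerive_eq_01.
Qed.

Lemma twice_derivable_at_eq_01 (u v : R -> C) (x : R) :
  (forall t, 0 < t < 1 -> u t = v t) -> 0 < x < 1 ->
  twice_derivable_at u x -> twice_derivable_at v x.
Proof.
  intros H Hx [Hu Hu']. split.
  - apply (ex_derive_ext_loc u); [|exact Hu].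
    generalize (locally_01 x Hx). apply filter_imp. exact H.
  - apply (ex_derive_ext_loc (CDerive u)); [|exact Hu'].
    generalize (locally_01 x Hx). apply filter_imp. intros t Ht. now apply CDerive_eq_01.
Qed.

Lemma Cmult_Cconj_Cmod (z : C) : (z * Cconj z)%C = RtoC (Cmod z ^ 2).
Proof.
  unfold Cmod. rewrite pow2_sqrt.
  - destruct z as [p q]. apply injective_projections; simpl; ring.
  - generalize (pow2_ge_0 (fst z)) (pow2_ge_0 (snd z)). lra.
Qed.

Lemma continuous_hyp_weight (a b : C) (c x : R) :
  0 < x < 1 -> continuous (hyp_weight a b c) x.
Proof.
  intro Hx. apply (ex_derive_continuous (V := R_NormedModule)).
  unfold hyp_weight, Rpower. auto_derive. lra.
Qed.

Theorem theorem3p2 (a b : C) (c : R) (kappa : C) (y1 f : R -> C)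
    (lam : nat -> C) (Y : nat -> R -> C)
    (hab_sum : Im (a + b)%C = 0) (hab_prod : Im (a * b)%C = 0)
    (hc : forall n : nat, c <> - INR n)
    (hy1 : forall x, 0 < x < 1 -> y1 x = (kappa * hyp2F1 a b c x)%C)
    (hnorm : is_inner a b c y1 y1 (RtoC 1))
    (hf : forall x, 0 < x < 1 -> continuous f x)
    (hlam0 : lam 0%nat = (a * b)%C)
    (hY0 : forall x, 0 < x < 1 -> Y 0%nat x = y1 x)
    (heig : deformed_eigenfunction a b c f y1 lam Y) :
  is_int01
    (fun x => RtoC (Cmod (y1 x) ^ 2) * RtoC (hyp_weight a b c x) * f x)%C
    (lam 1%nat).
Proof.
  destruct heig as [Hdiff [Hbd Hode]].
  assert (Hy1diff : forall x, 0 < x < 1 -> twice_derivable_at y1 x).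
  { intros x Hx. apply (twice_derivable_at_eq_01 (Y 0%nat)); auto. }
  assert (Hode0 : forall x, 0 < x < 1 -> hypL a b c y1 x = (a * b * y1 x)%C).
  { intros x Hx. rewrite <- (hypL_eq_01 a b c (Y 0%nat) y1 x hY0 Hx).
    generalize (Hode 0%nat x Hx). unfold deformed_op, fps_mul.
    rewrite sum_O, hlam0. simpl. rewrite (hY0 x Hx), Cplus_0_r. auto. }
  (* Order 1 of the Cauchy product is [lam 0 * Y 1 + lam 1 * Y 0], and the deformation contributes
     [f * Y 0]. *)
  assert (Hode1 : forall x, 0 < x < 1 -> hypL a b c (Y 1%nat) x
            = (a * b * Y 1%nat x + (lam 1%nat - f x) * y1 x)%C).
  { intros x Hx. generalize (Hode 1%nat x Hx). unfold deformed_op, fps_mul.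
    rewrite sum_Sn, sum_O, hlam0. simpl. rewrite (hY0 x Hx).
    unfold plus; simpl. intro H.
    transitivity (hypL a b c (Y 1%nat) x + f x * y1 x - f x * y1 x)%C; [ring|].
    rewrite H. ring. }
  (* The integrand is the derivative of the Lagrange bracket of [Y 1] and [y1]; both ends have the
     same limit [l], so the integral is [l - l = 0]. *)
  assert (Hint : is_int01
    (fun x => (lam 1%nat - f x) * (y1 x * Cconj (y1 x) * RtoC (hyp_weight a b c x)))%C
    (RtoC 0)).
  { destruct (Hbd 1%nat) as [l [H0 H1]].
    pose proof (is_RInt_gen_derive C_R_CompleteNormedModule (at_right 0) (at_left 1)
      (lagrange_bracket a b c (Y 1%nat) y1)
      (fun x => (lam 1%nat - f x) * (y1 x * Cconj (y1 x) * RtoC (hyp_weight a b c x)))%C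
      l l) as H.
    rewrite minus_eq_zero in H. refine (H _ H0 H1). clear H.
    generalize filter_prod_01_segment. apply filter_imp.
    intros st Hst x Hx. apply Hst in Hx. split.
    - evar_last; [apply is_derive_lagrange_bracket; auto|].
      rewrite (Hode0 x Hx), (Hode1 x Hx), !Cmult_conj.
      (* Since [ab] is real, the conjugated eigenvalue equals the eigenvalue and the two terms
         [ab * Y 1 * conj y1] cancel. *)
      replace (Cconj a * Cconj b)%C with (a * b)%C; [ring|].
      rewrite <- Cmult_conj. destruct (a * b)%C as [p q].
      simpl in hab_prod. rewrite hab_prod. unfold Cconj. simpl. now rewrite Ropp_0.
    (* The fundamental theorem also asks for a continuous derivative; this is where continuity of
       [f] enters. *)
    - pose proof (ex_derive_continuous (V := C_R_NormedModule) _ _ (proj1 (Hy1diff x Hx))) as Hc.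
      apply (continuous_Cmult (T := R_UniformSpace) (fun t => lam 1%nat - f t)%C);
        [|apply (continuous_Cmult (T := R_UniformSpace) (fun t => y1 t * Cconj (y1 t))%C);
          [apply (continuous_Cmult (T := R_UniformSpace) y1)|]].
      + apply (continuous_minus (V := C_R_NormedModule)); [apply continuous_const | now apply hf].
      + exact Hc.
      + apply continuous_C; [exact (continuous_Re _ _ Hc)|].
        exact (continuous_opp (V := R_NormedModule) _ _ (continuous_Im _ _ Hc)).
      + apply continuous_C; [now apply continuous_hyp_weight | apply continuous_const]. }
  (* Subtract [Hint] from [lam 1] times the normalization: the integrands differ by
     [f |y1|^2 omega], the values by [lam 1]. Convergence of the integral in the conclusion is
     obtained here as well, not assumed. *)
  pose proof (is_RInt_gen_minus _ _ _ _ (is_RInt_gen_Cmult_l _ _ (lam 1%nat) _ _ hnorm) Hint) as H.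
  unfold is_int01.
  replace (lam 1%nat) with (minus (lam 1%nat * RtoC 1)%C (RtoC 0) : C_R_NormedModule).
  - revert H. apply is_RInt_gen_ext. apply filter_forall. intros st x _.
    rewrite <- Cmult_Cconj_Cmod.
    change (minus (G := C_R_NormedModule)) with Cminus.
    change (@eq C_R_NormedModule) with (@eq C). ring.
  - change (lam 1%nat * RtoC 1 - RtoC 0 = lam 1%nat)%C. ring.
Qed.
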